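(* Let $H$ be a finite horizon (possibly with mass at zero) with $\mu:=\mathbb{E}H<\infty$, and let $m:=\sup\operatorname{supp}(H)\in\mathbb{N}\cup\{\infty\}$. Then: (a) $\mathcal{V}(\mathbf{Y})=\mathcal{V}(\mathbf{Z})$; (b) there exists $\bar\zeta\in\mathcal{T}$ such that $\mathbb{E}Z_{\bar\zeta}=\mathcal{V}(\mathbf{Z})$; (c) $\bar\tau:=\bar\zeta\wedge(H+1)$ satisfies $\mathbb{E}Y_{\bar\tau}=\mathcal{V}(\mathbf{Y})$. Moreover, $\bar\zeta$ can be taken to be the backward induction stopping rule for $Z_0,Z_1,\dots,Z_m$ if $m<\infty$, and the Snell rule for $\mathbf{Z}$ if $m=\infty$.
   Context: $X$ is a nonnegative integrable random variable, $X_1,X_2,\dots$ i.i.d. copies, and $X_0:=0$. $H$ is a random variable with values in $\{0,1,2,\dots\}$, $\mathbb{P}(H<\infty)=1$, independent of the $X_i$; $S(i):=\mathbb{P}(H\ge i)$. Reward sequence $\mathbf{Y}$: $Y_0:=X_0$, $Y_i:=X_i\mathbb{1}_{\{H\ge i\}}$ for $i\in\mathbb{N}$, $Y_\infty:=\limsup_i Y_i=0$; filtration $\mathcal{F}_0$ trivial, $\mathcal{F}_i=\sigma(\mathbb{1}_{\{H=0\}},X_1,\dots,\mathbb{1}_{\{H=i-1\}},X_i)$, $\mathcal{F}_\infty=\sigma(\bigcup_i\mathcal{F}_i)$. $\mathcal{T}^*$ is the class of stopping times for $(\mathcal{F}_i)$ with values in $\{0,1,\dots\}\cup\{\infty\}$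 (possibly infinite with positive probability). Discounted problem $\mathbf{Z}$: $Z_0:=Y_0$, $Z_i:=S(i)X_i$ for $i\in\mathbb{N}$, $Z_\infty:=\limsup_iZ_i=0$; filtration $\mathcal{B}_0$ trivial, $\mathcal{B}_i=\sigma(X_1,\dots,X_i)$, $\mathcal{B}_\infty=\sigma(\bigcup_i\mathcal{B}_i)$; $\mathcal{T}$ is the class of possibly infinite stopping times for $(\mathcal{B}_i)$, and $\mathcal{T}_i\subseteq\mathcal{T}$ those with $\zeta\ge i$. Values: $\mathcal{V}(\mathbf{Y})=\sup_{\tau\in\mathcal{T}^*}\mathbb{E}Y_\tau$, $\mathcal{V}(\mathbf{Z})=\sup_{\zeta\in\mathcal{T}}\mathbb{E}Z_\zeta$. Backward induction rule for the finite sequence $Z_0,\dots,Z_m$: set $W_m=Z_m$, $W_i=\max(Z_i,\mathbb{E}[W_{i+1}\mid\mathcal{B}_i])$, and stop at the first $i\le m$ with $Z_i\ge\mathbb{E}[W_{i+1}\mid\mathcal{B}_i]$ (with stopping at $m$ otherwise). Snell envelope of $\mathbf{Z}$: $V_i=\operatorname{ess\,sup}_{\zeta\in\mathcal{T}_i}\mathbb{E}[Z_\zeta\mid\mathcal{B}_i]$; Snell rule: $\bar\zeta=\inf\{i\in\{0,1,\dots\}: Z_i\ge\mathbb{E}[V_{i+1}\mid\mathcal{B}_i]\}$. *)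

(* Defs.v *)
From HB Require Import structures.
From mathcomp Require Import all_boot all_order all_algebra.
From mathcomp Require Import all_classical all_reals all_analysis.
Set Implicit Arguments. Unset Strict Implicit. Unset Printing Implicit Defensive.
Import Order.TTheory GRing.Theory Num.Theory.
Local Open Scope classical_set_scope.
Local Open Scope ring_scope.

Section OptimalStopping.
Context {R : realType} {d : measure_display} {T : measurableType d}.
Variable P : probability T R.

(* Possibly infinite times: [Some i] = i, [None] = infinity. *)

(* Mutual independence of H and the sequence (X_i)_{i>=1}: product rule over
   every finite family of indices. *)
Definition horizon_indep (X : nat -> T -> R) (H : T -> nat) :=
  forall (s : seq nat) (A : set nat) (B : nat -> set R),
    uniq s -> (forall i, i \in s -> (0 < i)%N /\ measurable (B i)) ->
    fine (P ([set t | A (H t)] `&` [set t | forall i, i \in s -> B i (X i t)]))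
    = fine (P (H @^-1` A)) * \prod_(i <- s) fine (P (X i @^-1` B i)).

Definition ident_distr (X : nat -> T -> R) :=
  forall i, (0 < i)%N -> forall B : set R, measurable B ->
    P (X i @^-1` B) = P (X 1%N @^-1` B).

Definition surv (H : T -> nat) (i : nat) : R := fine (P [set t | (i <= H t)%N]).

(* reward sequence Y: Y_0 = X_0 = 0, Y_i = X_i 1_{H >= i} *)
Definition Yseq (X : nat -> T -> R) (H : T -> nat) (i : nat) (t : T) : R :=
  if i is 0 then 0 else if (i <= H t)%N then X i t else 0.

Definition Zseq (X : nat -> T -> R) (H : T -> nat) (i : nat) (t : T) : R :=
  if i is 0 then 0 else surv H i * X i t.

Definition stopped (Y : nat -> T -> R) (tau : T -> option nat) (t : T) : R :=
  match tau t with Some i => Y i t | None => 0 end.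

Definition Ffilt (X : nat -> T -> R) (H : T -> nat) (i : nat) : set (set T) :=
  <<s [set A | (exists j (B : set R), (0 < j <= i)%N /\ measurable B /\ A = X j @^-1` B)
            \/ (exists j, (j < i)%N /\ A = H @^-1` [set j])] >>.

Definition Bfilt (X : nat -> T -> R) (i : nat) : set (set T) :=
  <<s [set A | exists j (B : set R), (0 < j <= i)%N /\ measurable B /\ A = X j @^-1` B] >>.

Definition stopping_time (F : nat -> set (set T)) (tau : T -> option nat) :=
  forall i, F i [set t | tau t = Some i].

Definition ge_time (i : nat) (tau : T -> option nat) :=
  forall t, match tau t with Some j => (i <= j)%N | None => true end.

Definition value (F : nat -> set (set T)) (Y : nat -> T -> R) : \bar R :=
  ereal_sup [set (\int[P]_t (stopped Y tau t)%:E)%E | tau in stopping_time F].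

Definition expect_stopped (Y : nat -> T -> R) (tau : T -> option nat) : \bar R :=
  (\int[P]_t (stopped Y tau t)%:E)%E.

Definition min_horizon (zeta : T -> option nat) (H : T -> nat) : T -> option nat :=
  fun t => match zeta t with
           | Some i => Some (minn i (H t).+1)
           | None => Some (H t).+1 end.

Definition G_measurable (G : set (set T)) (g : T -> R) :=
  forall B : set R, measurable B -> G (g @^-1` B).

Definition cexp_version (G : set (set T)) (f g : T -> R) :=
  [/\ G_measurable G g, P.-integrable setT (EFin \o g) &
      forall A, G A -> (\int[P]_(t in A) (g t)%:E = \int[P]_(t in A) (f t)%:E)%E].

Definition is_esssup (Fam : set (T -> R)) (V : T -> R) :=
  [/\ measurable_fun setT V,
      forall f, Fam f -> {ae P, forall t, f t <= V t} &
      forall U : T -> R, measurable_fun setT U ->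
        (forall f, Fam f -> {ae P, forall t, f t <= U t}) ->
        {ae P, forall t, V t <= U t}].

Definition snell_envelope (B : nat -> set (set T)) (Z : nat -> T -> R)
    (V : nat -> T -> R) :=
  forall i, is_esssup [set g | exists zeta, [/\ stopping_time B zeta, ge_time i zeta &
                                 cexp_version (B i) (stopped Z zeta) g]] (V i).

Definition first_hit (p : nat -> T -> bool) : T -> option nat := fun t =>
  match pselect (exists i, p i t) with
  | left h => Some (@ex_minn (fun i => p i t) h)
  | right _ => None
  end.

(* Snell rule: inf { i : Z_i >= C_i }, C_i a version of E[V_{i+1} | B_i] *)
Definition snell_rule (Z C : nat -> T -> R) : T -> option nat :=
  first_hit (fun i t => C i t <= Z i t).

Definition backward_induction (B : nat -> set (set T)) (m : nat)
    (Z W C : nat -> T -> R) :=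
  (forall t, W m t = Z m t) /\
  forall i, (i < m)%N ->
    cexp_version (B i) (W i.+1) (C i) /\ forall t, W i t = Num.max (Z i t) (C i t).

Definition bi_rule (m : nat) (Z C : nat -> T -> R) : T -> option nat := fun t =>
  match first_hit (fun i t => (i < m)%N && (C i t <= Z i t)) t with
  | Some i => Some i
  | None => Some m
  end.

Definition supp_max (H : T -> nat) (m : nat) :=
  (0 < P (H @^-1` [set m]))%E /\
  forall n, (m < n)%N -> P (H @^-1` [set n]) = 0%E.

Definition supp_unbounded (H : T -> nat) :=
  forall n, exists k, (n <= k)%N /\ (0 < P (H @^-1` [set k]))%E.

End OptimalStopping.

(* Main.v *)
(* Since Z_{i+1} = S(i+1) X_{i+1} is independent of B_i, optimal stopping of Z is
   governed by constants: let c_i >= 0 solve c_i = E[max(S(i+1) X_{i+1}, c_{i+1})]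
   with c_i -> 0, and put U_i = max(Z_i, c_i).  For A in B_i and any zeta >= i,
   the quantity E[Z_zeta; A, zeta <= n] + c_n P(A, zeta > n) is nonincreasing in
   n and at most E[U_i; A], with equality throughout for the rule "stop at the
   first j >= i with Z_j >= c_j"; letting n -> oo, this rule is optimal.
   Consequently U_i is the Snell envelope and c_i is a version of
   E[V_{i+1} | B_i] (resp. E[W_{i+1} | B_i]), so that the Snell rule and the
   backward induction rule coincide a.s. with the threshold rule.

   Independence of H gives E Y_zeta = E Z_zeta for every zeta in T, and
   Y_{zeta /\ (H+1)} = Y_zeta pointwise.  Conversely, F_i and B_i have the same
   trace on {H >= i}, so each tau in T* has a zeta in T with Y_tau <= Y_zeta. *)

Require Import Defs.
From HB Require Import structures.
From mathcomp Require Import all_boot all_order all_algebra.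
From mathcomp Require Import all_classical all_reals all_analysis.
From mathcomp Require Import measurable_realfun lra.
Set Implicit Arguments.
Unset Strict Implicit.
Unset Printing Implicit Defensive.
Import Order.TTheory GRing.Theory Num.Theory numFieldNormedType.Exports.
Local Open Scope classical_set_scope.
Local Open Scope ring_scope.

(** * Preliminaries *)

Lemma ge0_integral_mrestr d (T : measurableType d) (R : realType)
    (mu : measure T R) (E : set T) (mE : measurable E) (f : T -> \bar R) :
  measurable_fun setT f -> (forall x, 0 <= f x)%E ->
  (\int[mrestr mu mE]_x f x = \int[mu]_(x in E) f x)%E.
Proof.
move=> mf f0.
rewrite (@ge0_negligible_integral _ _ _ (mrestr mu mE) setT (~` E))//; first last.
- by rewrite /= /mrestr setICl measure0.
- exact: measurableC.
rewrite setTD setCK; apply: eq_measure_integral => A mA AE.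
by rewrite /= /mrestr setIidl.
Qed.

(* Both sides integrate [g] against one measure on the target space: the image
   of [mu] restricted to [E1] under [f1]. *)
Lemma ge0_integral_transfer d d' (T : measurableType d) (U : measurableType d')
    (R : realType) (mu : measure T R) (E1 E2 : set T) (f1 f2 : T -> U) (k : R)
    (g : U -> \bar R) :
  measurable E1 -> measurable E2 -> measurable_fun setT f1 ->
  measurable_fun setT f2 -> 0 <= k ->
  (forall D, measurable D ->
    mu (f1 @^-1` D `&` E1) = (k%:E * mu (f2 @^-1` D `&` E2))%E) ->
  measurable_fun setT g -> (forall x, 0 <= g x)%E ->
  (\int[mu]_(x in E1) g (f1 x) = k%:E * \int[mu]_(x in E2) g (f2 x))%E.
Proof.
move=> mE1 mE2 mf1 mf2 k0 eqD mg g0.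
have push (f : T -> U) (E : set T) (mE : measurable E) :
    measurable_fun setT f ->
    (\int[mu]_(x in E) g (f x) = \int[pushforward (mrestr mu mE) f]_x g x)%E.
  move=> mf; rewrite [RHS]ge0_integral_pushforward//.
  by rewrite (ge0_integral_mrestr _ mE)//=; exact: measurableT_comp.
rewrite (push _ _ mE1)// (push _ _ mE2)//.
rewrite -(ge0_integral_mscale _ measurableT (NngNum k0))//.
by apply: eq_measure_integral => A mA _; rewrite /= /mscale/= /pushforward/mrestr eqD.
Qed.

(** The difference [f - g] is positive on [A] with integral at most 0, so it vanishes almost
    everywhere there. This turns integral comparisons on events of a filtration into almost sure
    ones. *)
Lemma le_integral_null d (T : measurableType d) (R : realType)
    (mu : measure T R) (A : set T) (f g : T -> R) : measurable A ->
  mu.-integrable setT (EFin \o f) -> mu.-integrable setT (EFin \o g) ->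
  (forall x, A x -> g x < f x) ->
  (\int[mu]_(x in A) (f x)%:E <= \int[mu]_(x in A) (g x)%:E)%E -> mu A = 0%E.
Proof.
move=> mA itf itg gf le_fg.
have itfA : mu.-integrable A (EFin \o f) by apply: integrableS itf.
have itgA : mu.-integrable A (EFin \o g) by apply: integrableS itg.
have mh : measurable_fun A (EFin \o (f \- g)).
  exact: measurable_int (integrableB mA itfA itgA).
have int0 : (\int[mu]_(x in A) `|((f x - g x)%:E)| = 0)%E.
  transitivity (\int[mu]_(x in A) ((EFin \o f) x - (EFin \o g) x))%E.
    by apply: eq_integral => x; rewrite inE => /gf fg; rewrite gee0_abs// lee_fin subr_ge0 ltW.
  rewrite integralB//; apply/eqP; rewrite eq_le; apply/andP; split.
    by rewrite sube_le0.
  rewrite -integralB//; apply: integral_ge0 => x /gf fg.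
  by rewrite lee_fin subr_ge0 ltW.
have [N [mN N0 subN]] := (ae_eq_integral_abs mu mA mh).1 int0.
apply: subset_measure0 N0 => //; move=> x Ax; apply: subN => /= /(_ Ax) [] /eqP.
by rewrite subr_eq0; have := gf _ Ax; rewrite lt_neqAle eq_sym => /andP[/negPf ->].
Qed.

(* The solution is the increasing limit of the finite-horizon solutions [a k],
   where [a k i] is the value with continuation value 0 at time [i + k]. *)
Lemma backward_recursion (R : realType) (phi : nat -> R -> R) (b : nat -> R)
    (M : R) :
  (forall i x, 0 <= x -> x <= phi i x <= x + b i) ->
  (forall i x y, x <= y -> phi i x <= phi i y <= phi i x + (y - x)) ->
  (forall n, \sum_(i < n) b i <= M) ->
  exists c : nat -> R, [/\ forall i, 0 <= c i,
    forall i, c i = phi i.+1 (c i.+1) & c n @[n --> \oo] --> 0].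
Proof.
move=> phib phiL bM.
pose fix a k i {struct k} := if k is k'.+1 then phi i.+1 (a k' i.+1) else 0.
have b0 i : 0 <= b i.
  by have /andP[] := phib i 0 (lexx _); lra.
have a0 k i : 0 <= a k i.
  elim: k i => //= k IH i; apply: le_trans (IH i.+1) _.
  by have /andP[] := phib i.+1 _ (IH i.+1).
have aS k i : a k i <= a k.+1 i.
  elim: k i => [|k IH] i; first exact: a0.
  by have /andP[] := phiL i.+1 _ _ (IH i.+1).
pose s n := \sum_(i < n) b i.
have sup_s : has_sup (range s).
  by split; [exists (s 0%N), 0%N|exists M => _ [n _ <-]; exact: bM].
pose L : R := sup (range s).
have sM n : s n <= L.
  by apply: ub_le_sup; [exact: sup_s.2|exists n].
(* Each backward step adds at most one [b j], so [a k i] is at most a tail of the series. The bound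
   is uniform in [k]: it makes the supremum finite and later sends [c] to 0. *)
have ale k i : a k i <= L - s i.+1.
  suff : a k i <= s (i.+1 + k)%N - s i.+1 by have := sM (i.+1 + k)%N; lra.
  elim: k i => /= [|k IH] i; first by rewrite addn0 subrr.
  have /andP[_] := phib i.+1 _ (a0 k i.+1); have := IH i.+1.
  rewrite addSnnS; rewrite {2}/s big_ord_recr/= -/(s _); lra.
have sup_a i : has_sup (range (a ^~ i)).
  split; first by exists (a 0%N i), 0%N.
  by exists (L - s i.+1) => _ [n _ <-].
pose c i := sup (range (a ^~ i)).
have ac k i : a k i <= c i by apply: ub_le_sup; [exact: (sup_a i).2|exists k].
have c0 i : 0 <= c i by exact: (ac 0%N).
have cs i : c i <= L - s i.+1.
  by apply: ge_sup => [|_ [k _ <-]]; [exact: (sup_a i).1|exact: ale].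
exists c; split => //.
- move=> i; apply/eqP; rewrite eq_le; apply/andP; split.
    apply: ge_sup => [|_ [k _ <-]]; first exact: (sup_a i).1.
    apply: le_trans (aS k i) _ => /=.
    by have /andP[] := phiL i.+1 _ _ (ac k i.+1).
  (* The 1-Lipschitz bound supplies the continuity needed to pass [phi] through the supremum. *)
  apply/ler_addgt0Pr => e e0.
  have [_ [k _ <-]] := sup_adherent e0 (sup_a i.+1).
  rewrite -/(c _) => ck; have /andP[_] := phiL i.+1 _ _ (ac k i.+1).
  have := ac k.+1 i => /=; lra.
- have scvg : s n @[n --> \oo] --> L.
    apply: nondecreasing_cvgn; last exact: sup_s.2.
    by apply/nondecreasing_seqP => n; rewrite /s big_ord_recr/= lerDl.
  apply: (@squeeze_cvgr _ _ _ _ (fun=> 0) (fun n => L - s n.+1)).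
  + by near=> n; rewrite c0 cs.
  + exact: cvg_cst.
  + rewrite -[X in _ --> X](subrr (L)); apply: cvgB; first exact: cvg_cst.
    by rewrite (cvg_shiftS s).
Unshelve. all: by end_near.
Qed.

(** * Filtrations and independence *)

Section Filtration.
Context {R : realType} {d : measure_display} {T : measurableType d}.
Variable X : nat -> T -> R.
Hypothesis mX : forall i, (0 < i)%N -> measurable_fun setT (X i).

(** Naming the generators exhibits [Bfilt X i] as the measurable sets of a generated measurable
    type, so the usual closure and comparison lemmas apply to it. *)
Definition Bgen (i : nat) : set (set T) :=
  [set A | exists j (B : set R), (0 < j <= i)%N /\ measurable B /\ A = X j @^-1` B].

Lemma BfiltE i : Bfilt X i = (Bgen i).-sigma.-measurable.
Proof. by []. Qed.

Lemma Bfilt_mono i j : (i <= j)%N -> Bfilt X i `<=` Bfilt X j.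
Proof.
move=> ij; apply: sub_sigma_algebra2 => A [k [D [/andP[k0 ki] [mD ->]]]].
by exists k, D; rewrite k0 (leq_trans ki ij).
Qed.

Lemma Bfilt_measurable i : Bfilt X i `<=` measurable.
Proof.
apply: smallest_sub; first exact: sigma_algebra_measurable.
move=> A [k [D [/andP[k0 ki] [mD ->]]]].
by rewrite -[_ @^-1` _]setTI; exact: mX.
Qed.

Lemma Bfilt_preimage i j (D : set R) : (0 < i <= j)%N -> measurable D ->
  Bfilt X j (X i @^-1` D).
Proof. by move=> ij mD; apply: sub_sigma_algebra; exists i, D. Qed.

Lemma BfiltT i : Bfilt X i setT.
Proof. by rewrite BfiltE; exact: measurableT. Qed.

Lemma BfiltI i A D : Bfilt X i A -> Bfilt X i D -> Bfilt X i (A `&` D).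
Proof. by rewrite BfiltE; exact: measurableI. Qed.

Lemma BfiltC i A : Bfilt X i A -> Bfilt X i (~` A).
Proof. by rewrite BfiltE; exact: measurableC. Qed.

Lemma Bfilt_measurable_fun i (g : T -> R) : G_measurable (Bfilt X i) g ->
  measurable_fun setT (g : g_sigma_algebraType (Bgen i) -> R).
Proof. by move=> mg _ D mD; rewrite setTI; exact: mg. Qed.

Lemma G_measurable_fun i (g : T -> R) : G_measurable (Bfilt X i) g ->
  measurable_fun setT g.
Proof. by move=> mg _ D mD; rewrite setTI; exact: Bfilt_measurable (mg _ mD). Qed.

Lemma Bfilt_lt i (f g : T -> R) : G_measurable (Bfilt X i) f ->
  G_measurable (Bfilt X i) g -> Bfilt X i [set t | f t < g t].
Proof.
move=> mf mg; rewrite -[X in Bfilt _ _ X]setTI BfiltE.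
apply: (measurable_fun_ltr (Bfilt_measurable_fun mf) (Bfilt_measurable_fun mg)
  measurableT (I : measurable [set true])).
Qed.

Lemma Bfilt_le i (f g : T -> R) : G_measurable (Bfilt X i) f ->
  G_measurable (Bfilt X i) g -> Bfilt X i [set t | f t <= g t].
Proof.
move=> mf mg; rewrite -[X in Bfilt _ _ X]setTI BfiltE.
exact: (measurable_fun_ler (Bfilt_measurable_fun mf) (Bfilt_measurable_fun mg)
  measurableT (I : measurable [set true])).
Qed.

Lemma stopping_le i (zeta : T -> option nat) : stopping_time (Bfilt X) zeta ->
  Bfilt X i [set t | exists2 j, (j <= i)%N & zeta t = Some j].
Proof.
move=> sz; rewrite (_ : mkset _ = \bigcup_(j in `I_i.+1) [set t | zeta t = Some j]).
  rewrite BfiltE; apply: bigcup_measurable => j /= ji.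
  by apply: (@Bfilt_mono j) => //; exact: sz.
by apply/seteqP; split => t [j ji ztj]; exists j.
Qed.

Lemma first_hit_stopping (p : nat -> T -> bool) :
  (forall i, Bfilt X i [set t | p i t]) -> stopping_time (Bfilt X) (first_hit p).
Proof.
move=> mp i; rewrite (_ : mkset _ =
    [set t | p i t] `&` \bigcap_(j in `I_i) ~` [set t | p j t]).
  apply: BfiltI => //; rewrite BfiltE; apply: bigcap_measurableType => j ji.
  by apply: BfiltC; apply: (@Bfilt_mono j); [exact: ltnW|exact: mp].
apply/seteqP; split => t; rewrite /first_hit/=; case: pselect => h //.
- case: ex_minnP => n pn nmin [<-]; split => // j /= jn pj.
  by have := nmin _ pj; rewrite leqNgt jn.
- case: ex_minnP => n pn nmin [pi pj]; congr Some; apply/eqP.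
  rewrite eqn_leq nmin//= leqNgt; apply/negP => ni.
  by have := pj _ ni; apply.
- by move=> [pi _]; case: h; exists i.
Qed.

End Filtration.

(** * Independence of the past, the next reward and the horizon *)

Section Independence.
Context {R : realType} {d : measure_display} {T : measurableType d}.
Variables (P : probability T R) (X : nat -> T -> R) (H : T -> nat).
Hypothesis mX : forall i, (0 < i)%N -> measurable_fun setT (X i).
Hypothesis mH : forall n, measurable (H @^-1` [set n]).
Hypothesis idX : ident_distr P X.
Hypothesis indep : horizon_indep P X H.

Let cyl (s : seq nat) (D : nat -> set R) :=
  [set t | forall i, i \in s -> D i (X i t)].

Let measurable_cyl s D : (forall i, i \in s -> (0 < i)%N /\ measurable (D i)) ->
  measurable (cyl s D).
Proof.
move=> sD; rewrite (_ : cyl s D = \bigcap_(i in [set` s]) (X i @^-1` D i)).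
  apply: bigcap_measurableType => i /= /sD [i0 mD].
  by rewrite -[_ @^-1` _]setTI; exact: mX.
by apply/seteqP; split.
Qed.

Lemma measurable_survival i : measurable [set t | (i <= H t)%N].
Proof.
rewrite (_ : mkset _ = \bigcup_(j in [set j | (i <= j)%N]) (H @^-1` [set j])).
  exact: bigcup_measurable.
by apply/seteqP; split => [t /= iH|t [j /= ij ->//]]; exists (H t).
Qed.

Lemma survE i : (surv P H i)%:E = P [set t | (i <= H t)%N].
Proof. by rewrite /surv fineK// fin_num_measure//; exact: measurable_survival. Qed.

Lemma surv_ge0 i : 0 <= surv P H i.
Proof. by rewrite /surv fine_ge0. Qed.

(* It suffices to test independence from [E] on the cylinders, which form a
   pi-system generating [Bfilt X n]. *)
Let indep_Bfilt n (E : set T) : measurable E ->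
  (forall D, (forall i, measurable (D i)) ->
     P (cyl (iota 1 n) D `&` E) = (P E * P (cyl (iota 1 n) D))%E) ->
  forall A, Bfilt X n A -> P (A `&` E) = (P E * P A)%E.
Proof.
move=> mE cylE A BA.
pose G := [set C | exists D, (forall i, measurable (D i)) /\ C = cyl (iota 1 n) D].
have iotaP i : i \in iota 1 n -> (0 < i)%N by rewrite mem_iota => /andP[].
have mG : G `<=` measurable.
  by move=> _ [D [mD ->]]; apply: measurable_cyl => i /iotaP.
have PE0 : 0 <= fine (P E) by exact: fine_ge0.
(* Both sides are finite measures in [A]: [P] restricted to [E], and [P] scaled by [P E]. *)
have := @g_sigma_algebra_measure_unique _ _ _ G mG (fun=> setT) _ _
  (mrestr P mE) (mscale (NngNum PE0) P) _ _ _ A.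
rewrite /mrestr/= /mscale/= fineK ?fin_num_measure//; apply.
- by move=> _; exists (fun=> setT); split => //; apply/seteqP; split.
- by apply/seteqP; split => // t _; exists 0%N.
- move=> _ _ [D [mD ->]] [D' [mD' ->]]; exists (fun i => D i `&` D' i); split.
    by move=> i; exact: measurableI.
  apply/seteqP; split => [t [Dt D't] i si|t DD']; first by split; [exact: Dt|exact: D't].
  by split => i /DD' [].
- by move=> _ [D [mD ->]]; rewrite -cylE.
- by move=> _; rewrite /mrestr setTI ltey_eq fin_num_measure.
(* A generator constrains a single coordinate: it is the cylinder with [setT] at all others. *)
- move: A BA; apply: sub_sigma_algebra2 => _ [j [D [/andP[j0 jn] [mD ->]]]].
  exists (fun i => if i == j then D else setT); split; first by move=> i; case: ifP.
  apply/seteqP; split => [t Dt i _|t /(_ j)]; first by case: eqP => [->|].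
  by rewrite eqxx; apply; rewrite mem_iota j0.
Qed.

Let P_cyl s D : uniq s -> (forall i, i \in s -> (0 < i)%N /\ measurable (D i)) ->
  P (cyl s D) = (\prod_(i <- s) fine (P (X i @^-1` D i)))%:E.
Proof.
move=> us sD; have := indep setT us sD; rewrite preimage_setT probability_setT mul1r.
rewrite (_ : mkset _ = setT)// setTI => <-.
by rewrite fineK// fin_num_measure//; exact: measurable_cyl.
Qed.

(** Intersecting a cylinder over [1..n] with a condition on [X n.+1] gives a cylinder over distinct
    indices, to which the product rule applies. Identical distribution then replaces [X n.+1] by
    [X 1]. *)
Lemma indep_next n D A : measurable D -> Bfilt X n A ->
  P (X n.+1 @^-1` D `&` A) = (P A * P (X 1%N @^-1` D))%E.
Proof.
move=> mD BA; have mE : measurable (X n.+1 @^-1` D).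
  by rewrite -[_ @^-1` _]setTI; exact: mX.
rewrite setIC (@indep_Bfilt n)// => [|D' mD']; first by rewrite idX// muleC.
pose D'' i := if i == n.+1 then D else D' i.
have iotaP i : i \in iota 1 n -> (0 < i)%N by rewrite mem_iota => /andP[].
have nn : n.+1 \notin iota 1 n by rewrite mem_iota add1n ltnn andbF.
have -> : cyl (iota 1 n) D' `&` X n.+1 @^-1` D = cyl (n.+1 :: iota 1 n) D''.
  apply/seteqP; split => [t [Dt Et] i|t Dt].
    by rewrite inE /D''; case: eqP => [->//|_ /= /Dt].
  split; last by have := Dt n.+1; rewrite inE /D'' eqxx; apply.
  move=> i si; have := Dt i; rewrite inE /D'' si orbT => /(_ isT).
  by case: eqP => // ni; move: nn; rewrite -ni si.
rewrite (@P_cyl (iota 1 n)) ?iota_uniq// => [|i /iotaP//].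
rewrite P_cyl => [||i]; last by rewrite inE /D''; case: eqP => [->//|_ /= /iotaP].
  2: by rewrite /= nn iota_uniq.
rewrite big_cons EFinM {1}/D'' eqxx fineK ?fin_num_measure//; congr (_ * _%:E)%E.
by apply: eq_big_seq => i si; rewrite /D''; case: eqP => // ni; move: nn; rewrite -ni si.
Qed.

Lemma indep_survival n k A : Bfilt X n A ->
  P (A `&` [set t | (k <= H t)%N]) = ((surv P H k)%:E * P A)%E.
Proof.
move=> BA; have mE := measurable_survival k.
rewrite (@indep_Bfilt n) ?survE// => D mD.
have iotaP i : i \in iota 1 n -> (0 < i)%N /\ measurable (D i).
  by rewrite mem_iota => /andP[].
have mC := measurable_cyl iotaP.
have := congr1 EFin (indep [set j | (k <= j)%N] (iota_uniq 1 n) iotaP).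
rewrite EFinM -P_cyl ?iota_uniq// !fineK ?fin_num_measure//; last exact: measurableI.
by rewrite setIC.
Qed.

Lemma integral_next n A (g : R -> \bar R) : Bfilt X n A ->
  measurable_fun setT g -> (forall x, 0 <= g x)%E ->
  (\int[P]_(t in A) g (X n.+1 t) = P A * \int[P]_t g (X 1%N t))%E.
Proof.
move=> BA mg g0; have mA := Bfilt_measurable mX BA.
rewrite -[P A]fineK ?fin_num_measure//.
apply: ge0_integral_transfer => //; [exact: mX|exact: mX|exact: fine_ge0|].
by move=> D mD; apply: etrans (indep_next mD BA) _; rewrite setIT fineK ?fin_num_measure.
Qed.

(** The source of the discount in [Zseq]: seen from [Bfilt X n], survival up to [n] is an
    independent event of probability [surv P H n]. *)
Lemma integral_survival n A (g : R -> \bar R) : (0 < n)%N -> Bfilt X n A ->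
  measurable_fun setT g -> (forall x, 0 <= g x)%E ->
  (\int[P]_(t in A `&` [set t | (n <= H t)%N]) g (X n t) =
   (surv P H n)%:E * \int[P]_(t in A) g (X n t))%E.
Proof.
move=> n0 BA mg g0; have mA := Bfilt_measurable mX BA.
have mE := measurable_survival n.
apply: ge0_integral_transfer => //; [exact: measurableI|exact: mX|exact: mX|exact: surv_ge0|].
move=> D mD; rewrite setIA; apply: (@indep_survival n).
by apply: BfiltI => //; apply: Bfilt_preimage => //; rewrite n0 leqnn.
Qed.

End Independence.

(** * Stopped processes *)

Section StoppedProcess.
Context {R : realType} {d : measure_display} {T : measurableType d}.
Variables (P : probability T R) (Y : nat -> T -> R) (zeta : T -> option nat).
Hypothesis mY : forall i, measurable_fun setT (Y i).
Hypothesis Y0 : forall i t, 0 <= Y i t.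
Hypothesis mz : forall i, measurable [set t | zeta t = Some i].

Lemma stopped_ge0 t : 0 <= stopped Y zeta t.
Proof. by rewrite /stopped; case: zeta. Qed.

Lemma measurable_stopped : measurable_fun setT (stopped Y zeta).
Proof.
(* Index 0 is reserved for the value infinity, which makes the level sets a cover indexed by
   [nat]. *)
pose E i := if i is j.+1 then [set t | zeta t = Some j] else [set t | zeta t = None].
have E_cover : \bigcup_i E i = setT.
  apply/seteqP; split => // t _; case ztE : (zeta t) => [j|]; last by exists 0%N.
  by exists j.+1.
have mE i : measurable (E i).
  case: i => [|i] /=; last exact: mz.
  rewrite (_ : mkset _ = ~` \bigcup_i [set t | zeta t = Some i]).
    by apply: measurableC; exact: bigcup_measurable.
  apply/seteqP; split => t /=; first by move=> zt [i _] /=; rewrite zt.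
  by move=> nz; case zt : (zeta t) => [j|//]; case: nz; exists j.
rewrite -E_cover; apply/measurable_fun_bigcup => // -[|i] /=.
  apply: (eq_measurable_fun (cst (0 : R))) => [t|]; last exact: measurable_cst.
  by rewrite inE /stopped /= => ->.
apply: (eq_measurable_fun (Y i)) => [t|]; last exact: measurable_funTS.
by rewrite inE /stopped /= => ->.
Qed.

(** The event [zeta = None] contributes nothing, because [stopped] is 0 there. *)
Lemma integral_stopped A : measurable A ->
  (\int[P]_(t in A) (stopped Y zeta t)%:E =
   \sum_(0 <= i <oo) \int[P]_(t in A `&` [set t | zeta t = Some i]) (Y i t)%:E)%E.
Proof.
move=> mA; pose E i := A `&` [set t | zeta t = Some i].
have mE i : measurable (E i) by exact: measurableI.
transitivity (\int[P]_(t in \bigcup_i E i) (stopped Y zeta t)%:E)%E.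
  rewrite integral_mkcond [RHS]integral_mkcond; apply: eq_integral => t _.
  rewrite !patchE; case: ifPn; case: ifPn => //; rewrite !(inE, notin_setE).
  - move=> nE At; rewrite /stopped; case ztE : (zeta t) => [i|//].
    by case: nE; exists i.
  - by case=> i _ [].
rewrite ge0_integral_bigcup//.
- apply: eq_eseriesr => i _; apply: eq_integral => t; rewrite inE => -[_ /= zt].
  by rewrite /stopped zt.
- by apply: measurable_funTS; apply/measurable_EFinP; exact: measurable_stopped.
- by move=> t _; rewrite lee_fin stopped_ge0.
- apply/trivIsetP => i j _ _ /eqP ij; rewrite -subset0 => t [[_ /= zi] [_ /=]].
  by rewrite zi => -[/ij].
Qed.

End StoppedProcess.

(** * First hitting times, pointwise *)

Lemma first_hitP d (T : measurableType d) (p : nat -> T -> bool) t i :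
  first_hit p t = Some i <-> p i t /\ forall j, p j t -> (i <= j)%N.
Proof.
rewrite /first_hit; case: pselect => h; last by split => // -[pi _]; case: h; exists i.
case: ex_minnP => n pn nmin; split => [[<-]//|[pi imin]]; congr Some.
by apply/eqP; rewrite eqn_leq nmin// imin.
Qed.

Lemma first_hit_le d (T : measurableType d) (p : nat -> T -> bool) t i :
  p i t -> exists2 j, (j <= i)%N & first_hit p t = Some j.
Proof.
move=> pi; rewrite /first_hit; case: pselect => h; last by case: h; exists i.
by case: ex_minnP => n pn nmin; exists n => //; exact: nmin.
Qed.

(** Agreement is asked only up to the first hit of [p]; this suits the backward induction rule,
    whose continuation values are constrained only before [m]. *)
Lemma eq_first_hit d (T : measurableType d) (p q : nat -> T -> bool) t :
  (forall i, (forall j, (j < i)%N -> ~~ p j t) -> p i t = q i t) ->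
  first_hit p t = first_hit q t.
Proof.
move=> pq; case hp : (first_hit p t) => [i|].
  move/first_hitP : hp => [pi imin]; apply/esym/first_hitP.
  have np j : (j < i)%N -> ~~ p j t.
    by move=> ji; apply/negP => /imin; rewrite leqNgt ji.
  split=> [|j qj]; first by rewrite -pq.
  rewrite leqNgt; apply/negP => ji; have := np _ ji; rewrite pq ?qj// => k kj.
  exact/np/(ltn_trans kj).
have np i : ~~ p i t.
  by apply/negP => pi; move: hp; rewrite /first_hit; case: pselect => // -[]; exists i.
case hq : (first_hit q t) => [i|//].
by move/first_hitP : hq => [qi _]; have := np i; rewrite pq ?qi.
Qed.

(** * Optimal stopping of the discounted sequence *)

Section Optimality.
Context {R : realType} {d : measure_display} {T : measurableType d}.
Variables (P : probability T R) (X : nat -> T -> R) (H : T -> nat).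
Hypothesis mX : forall i, (0 < i)%N -> measurable_fun setT (X i).
Hypothesis X0 : forall i, (0 < i)%N -> forall t, 0 <= X i t.
Hypothesis iX : P.-integrable setT (EFin \o X 1%N).
Hypothesis idX : ident_distr P X.
Hypothesis mH : forall n, measurable (H @^-1` [set n]).
Hypothesis indep : horizon_indep P X H.

Let S := surv P H.
Let Z := Zseq P X H.

Let S0 i : 0 <= S i. Proof. exact: surv_ge0. Qed.

Lemma Zseq_ge0 i t : 0 <= Z i t.
Proof. by case: i => [//|i]; rewrite /Z /= mulr_ge0// X0. Qed.

Lemma G_measurable_Zseq i : G_measurable (Bfilt X i) (Z i).
Proof.
move=> D mD; rewrite -[_ @^-1` _]setTI BfiltE.
suff : measurable_fun setT (Z i : g_sigma_algebraType (Bgen X i) -> R) by exact.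
case: i => [|i]; first exact: measurable_cst.
apply: measurable_funM; first exact: measurable_cst.
by move=> _ E mE; rewrite setTI; apply: Bfilt_preimage; rewrite ?leqnn.
Qed.

Lemma measurable_Zseq i : measurable_fun setT (Z i).
Proof. exact: G_measurable_fun (@G_measurable_Zseq i). Qed.

(** The one-step value of choosing between the reward at time [i] and a fallback [x]; [X 1] stands
    for [X i] since only the common law enters. *)
Definition reward_or (i : nat) (x : R) : R :=
  (\int[P]_t (Num.max (S i * X 1%N t) x))%R.

Let mXmax i x : measurable_fun setT (fun t => Num.max (S i * X 1%N t) x).
Proof.
by apply: measurable_maxr => //; apply: measurable_funM => //; exact: mX.
Qed.

Let iSX i : P.-integrable setT (EFin \o (fun t => S i * X 1%N t)).
Proof. by have := integrableZl measurableT (S i) iX. Qed.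

Let icst (x : R) : P.-integrable setT (EFin \o cst x).
Proof. exact: finite_measure_integrable_cst. Qed.

Let iXmax i x : P.-integrable setT (EFin \o (fun t => Num.max (S i * X 1%N t) x)).
Proof.
have i2 := integrableD measurableT (iSX i) (icst `|x|).
apply: le_integrable i2 => //; first exact/measurable_EFinP.
move=> t _ /=; rewrite lee_fin.
have SX : 0 <= S i * X 1%N t by rewrite mulr_ge0// X0.
rewrite ger0_norm ?le_max ?SX//; apply: le_trans (ler_norm _).
by rewrite ge_max lerDl normr_ge0 /= (le_trans (ler_norm x))// lerDr.
Qed.

Lemma reward_orE i x : (reward_or i x)%:E =
  (\int[P]_t (Num.max (S i * X 1%N t) x)%:E)%E.
Proof.
rewrite /reward_or /Rintegral fineK//.
exact: integrable_fin_num (iXmax i x).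
Qed.

Let int_cst (x : R) : (\int[P]_t x%:E = x%:E)%E.
Proof.
by rewrite integral_cst// -[RHS]mule1; congr (_ * _)%E; exact: probability_setT.
Qed.

Lemma reward_or_bounds i x : 0 <= x ->
  x <= reward_or i x <= x + S i * fine (\int[P]_t (X 1%N t)%:E)%E.
Proof.
move=> x0; have EXfin := fineK (integrable_fin_num measurableT iX).
rewrite -!lee_fin reward_orE EFinD EFinM EXfin.
rewrite -{1 2}(int_cst x) -integralZl// -integralD//; first last.
- exact: integrableZl.
- exact: icst.
apply/andP; split; apply: ge0_le_integral => //.
- by apply/measurable_EFinP; exact: mXmax.
- by move=> t _; rewrite lee_fin le_max lexx orbT.
- by move=> t _; rewrite lee_fin le_max x0 orbT.
- by apply/measurable_EFinP; exact: mXmax.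
- apply/measurable_EFinP/measurable_funD => //; apply: measurable_funM => //; exact: mX.
- move=> t _; have SX : 0 <= S i * X 1%N t by rewrite mulr_ge0// X0.
  by rewrite -EFinM -EFinD lee_fin ge_max lerDl lerDr x0 SX.
Qed.

(** Pointwise, the maximum with a fixed number is nondecreasing and 1-Lipschitz; the expectation
    inherits both. *)
Lemma reward_or_lipschitz i x y : x <= y ->
  reward_or i x <= reward_or i y <= reward_or i x + (y - x).
Proof.
move=> xy; rewrite -!lee_fin EFinD !reward_orE -(int_cst (y - x)) -integralD//; first last.
- exact: icst.
- exact: iXmax.
have SX t : 0 <= S i * X 1%N t by rewrite mulr_ge0// X0.
have mmax z : measurable_fun setT (fun t => (Num.max (S i * X 1%N t) z)%:E).
  by apply/measurable_EFinP; exact: mXmax.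
apply/andP; split; apply: ge0_le_integral => //.
- by move=> t _; rewrite lee_fin le_max SX.
- by move=> t _; rewrite lee_fin ge_max !le_max lexx xy orbT.
- by move=> t _; rewrite lee_fin le_max SX.
- exact: emeasurable_funD.
- move=> t _; rewrite -EFinD lee_fin ge_max.
  have : S i * X 1%N t <= Num.max (S i * X 1%N t) x by rewrite le_max lexx.
  have : x <= Num.max (S i * X 1%N t) x by rewrite le_max lexx orbT.
  by move=> xm Sm; apply/andP; split; lra.
Qed.

Lemma integrable_Zseq i : P.-integrable setT (EFin \o Z i).
Proof.
case: i => [|i]; first exact: icst.
have iXi : P.-integrable setT (EFin \o X i.+1).
  apply/integrableP; split; first by apply/measurable_EFinP; exact: mX.
  have /integrableP[_] := iX; apply: le_lt_trans.
  have mabs : measurable_fun setT (fun x : R => `|x%:E|%E) by apply: measurableT_comp.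
  have := integral_next mX idX indep (@BfiltT _ _ _ X i) mabs (fun=> abse_ge0 _).
  by rewrite (_ : P setT = 1%E) ?mul1e => [/= -> //|]; exact: probability_setT.
by have := integrableZl measurableT (S i.+1) iXi.
Qed.

(** * Thresholds and the candidate envelope *)

Variable c : nat -> R.
Hypothesis c0 : forall i, 0 <= c i.
Hypothesis cE : forall i, c i = reward_or i.+1 (c i.+1).
Hypothesis ccvg : c n @[n --> \oo] --> 0.

Definition payoff (i : nat) (t : T) : R := Num.max (Z i t) (c i).

Lemma payoff_ge0 i t : 0 <= payoff i t.
Proof. by rewrite /payoff le_max c0 orbT. Qed.

Let G_measurable_cst i (x : R) : G_measurable (Bfilt X i) (cst x).
Proof.
move=> D mD; rewrite -[_ @^-1` _]setTI BfiltE.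
suff : measurable_fun setT (cst x : g_sigma_algebraType (Bgen X i) -> R) by exact.
exact: measurable_cst.
Qed.

Lemma G_measurable_payoff i : G_measurable (Bfilt X i) (payoff i).
Proof.
move=> D mD; rewrite -[_ @^-1` _]setTI BfiltE.
suff : measurable_fun setT (payoff i : g_sigma_algebraType (Bgen X i) -> R) by exact.
by apply: measurable_maxr => //; exact: Bfilt_measurable_fun (@G_measurable_Zseq i).
Qed.

Lemma measurable_payoff i : measurable_fun setT (payoff i).
Proof. exact: G_measurable_fun (@G_measurable_payoff i). Qed.

Lemma integrable_payoff i : P.-integrable setT (EFin \o payoff i).
Proof.
have i2 := integrableD measurableT (integrable_Zseq i) (icst (c i)).
apply: le_integrable i2 => //; first by apply/measurable_EFinP; exact: measurable_payoff.
move=> t _ /=; rewrite lee_fin ger0_norm ?payoff_ge0//; apply: le_trans (ler_norm _).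
by rewrite ge_max lerDl lerDr c0 Zseq_ge0.
Qed.

(** The recursion for [c] combined with independence of [X n.+1] from [Bfilt X n]: the constant
    [c n] is a conditional expectation of [payoff n.+1]. *)
Lemma integral_payoff n A : Bfilt X n A ->
  (\int[P]_(t in A) (payoff n.+1 t)%:E = (c n)%:E * P A)%E.
Proof.
move=> BA; rewrite [c n]cE reward_orE muleC.
apply: (integral_next mX idX indep BA
  (g := fun x => (Num.max (S n.+1 * x) (c n.+1))%:E)).
- by apply/measurable_EFinP; apply: measurable_maxr => //; exact: measurable_funM.
- by move=> x; rewrite lee_fin le_max c0 orbT.
Qed.

Let integral_payoffU i E Q : measurable E -> measurable Q ->
  (\int[P]_(t in E) (payoff i t)%:E =
   \int[P]_(t in E `&` Q) (payoff i t)%:E + \int[P]_(t in E `\` Q) (payoff i t)%:E)%E.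
Proof.
move=> mE mQ; rewrite -{1}(setUIDK E Q) ge0_integral_setU//.
- exact: measurableI.
- exact: measurableD.
- by apply: measurable_funTS; apply/measurable_EFinP; exact: measurable_payoff.
- by move=> t _; rewrite lee_fin payoff_ge0.
- by apply/disj_setPS => t [[_ Qt] [_ /(_ Qt)]].
Qed.

(** Taking [Z i] on [Q] and [c i] off [Q] never beats the pointwise maximum; equality holds when [Q]
    selects the larger of the two. *)
Lemma le_payoff_split i E Q : measurable E -> measurable Q ->
  (\int[P]_(t in E `&` Q) (Z i t)%:E + (c i)%:E * P (E `\` Q) <=
   \int[P]_(t in E) (payoff i t)%:E)%E.
Proof.
move=> mE mQ; have mI := measurableI _ _ mE mQ; have mD := measurableD mE mQ.
have mU := measurable_payoff i; have mZ := measurable_Zseq i.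
rewrite (integral_payoffU _ mE mQ) -[X in (_ + X <= _)%E]integral_cst//.
apply: leeD; apply: ge0_le_integral => //.
- by move=> t _; rewrite lee_fin Zseq_ge0.
- by apply: measurable_funTS; apply/measurable_EFinP.
- by apply: measurable_funTS; apply/measurable_EFinP.
- by move=> t _; rewrite lee_fin le_max lexx.
- by move=> t _; rewrite lee_fin c0.
- by apply: measurable_funTS; apply/measurable_EFinP.
- by move=> t _; rewrite lee_fin le_max lexx orbT.
Qed.

Lemma eq_payoff_split i E Q : measurable E -> measurable Q ->
  (forall t, E t -> Q t -> c i <= Z i t) -> (forall t, E t -> ~ Q t -> Z i t <= c i) ->
  (\int[P]_(t in E `&` Q) (Z i t)%:E + (c i)%:E * P (E `\` Q) =
   \int[P]_(t in E) (payoff i t)%:E)%E.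
Proof.
move=> mE mQ geZ leZ; have mD := measurableD mE mQ.
rewrite (integral_payoffU _ mE mQ) -[X in (_ + X = _)%E]integral_cst//.
congr (_ + _)%E; apply: eq_integral => t; rewrite inE => -[Et Qt].
- by rewrite /payoff max_l// geZ.
- by rewrite /payoff max_r// leZ.
Qed.

(** The event [zeta > n], infinity included, as a complement so that [stopping_le] puts it in
    [Bfilt X n]. *)
Let alive (zeta : T -> option nat) n := ~` [set t | exists2 j, (j <= n)%N & zeta t = Some j].

Let aliveS zeta n A : (A `&` alive zeta n) `\` [set t | zeta t = Some n.+1] =
  A `&` alive zeta n.+1.
Proof.
apply/seteqP; split => t [].
  move=> [At al] /= nz; split=> // -[j]; rewrite leq_eqVlt => /predU1P[->//|ji zt].
  by apply: al; exists j.
move=> At al; split; last by move=> zt; apply: al; exists n.+1.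
by split=> // -[j ji zt]; apply: al; exists j => //; exact: ltnW.
Qed.

Let alive_hit zeta n A : A `&` alive zeta n `&` [set t | zeta t = Some n.+1] =
  A `&` [set t | zeta t = Some n.+1].
Proof.
apply/seteqP; split => [t [[At _] zt]//|t [At /= zt]].
by split=> //; split=> // -[j jn]; rewrite zt => -[nj]; rewrite -nj ltnn in jn.
Qed.

Let sum_first zeta i A (f : nat -> T -> R) : ge_time i zeta ->
  (\sum_(0 <= j < i.+1) \int[P]_(t in A `&` [set t | zeta t = Some j]) (f j t)%:E =
   \int[P]_(t in A `&` [set t | zeta t = Some i]) (f i t)%:E)%E.
Proof.
move=> gz; rewrite big_nat_recr//= big_nat big1 ?add0e// => j /= ji.
rewrite (_ : _ `&` _ = set0) ?integral_set0//.
apply/seteqP; split => // t [_ /= zt]; have := gz t; rewrite zt.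
by rewrite leqNgt ji.
Qed.

Let alive_first zeta i A : ge_time i zeta ->
  A `\` [set t | zeta t = Some i] = A `&` alive zeta i.
Proof.
move=> gz; apply/seteqP; split => t [At].
  move=> /= nz; split=> // -[j ji zt]; have := gz t; rewrite zt => ij.
  by apply: nz; rewrite zt; congr Some; apply/eqP; rewrite eqn_leq ji.
by move=> al; split=> // zt; apply: al; exists i.
Qed.

Section Rule.
Variable zeta : T -> option nat.
Hypothesis sz : stopping_time (Bfilt X) zeta.

Let mz i : measurable [set t | zeta t = Some i].
Proof. by apply: (Bfilt_measurable mX (i := i)); exact: sz. Qed.

Let Balive n : Bfilt X n (alive zeta n).
Proof. by apply: BfiltC; exact: stopping_le. Qed.

(* The left-hand side is the expected payoff of following [zeta] up to time [n]
   and receiving [c n] if [zeta] has not yet stopped: a supermartingale in [n]. *)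
Lemma le_partial_stopped i n A : ge_time i zeta -> Bfilt X i A -> (i <= n)%N ->
  (\sum_(0 <= j < n.+1) \int[P]_(t in A `&` [set t | zeta t = Some j]) (Z j t)%:E
   + (c n)%:E * P (A `&` alive zeta n) <= \int[P]_(t in A) (payoff i t)%:E)%E.
Proof.
move=> gz BA; have mA := Bfilt_measurable mX BA; elim: n => [|n IH].
  rewrite leqn0 => /eqP i0; subst i; rewrite sum_first// -alive_first//.
  exact: le_payoff_split.
rewrite leq_eqVlt => /predU1P[<-|]; first by rewrite sum_first// -alive_first// le_payoff_split.
move=> ni; apply: le_trans (IH ni).
have BE : Bfilt X n (A `&` alive zeta n) by apply: BfiltI => //; exact: Bfilt_mono BA.
(* On [zeta > n] the fallback [c n] is worth the integral of [payoff n.+1]; splitting this event at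
   [zeta = n.+1] yields the new summand and the new fallback. *)
rewrite big_nat_recr// -addeA -(integral_payoff BE); apply: leeD2l.
rewrite -aliveS -alive_hit.
by apply: le_payoff_split => //; exact: (Bfilt_measurable mX BE).
Qed.

(** If [zeta] stops only where [Z j] is at least [c j] and continues only where it is at most [c j],
    no split in the induction loses anything. *)
Lemma eq_partial_stopped i n A : ge_time i zeta -> Bfilt X i A -> (i <= n)%N ->
  (forall j t, zeta t = Some j -> c j <= Z j t) ->
  (forall j t, (i <= j)%N -> alive zeta j t -> Z j t <= c j) ->
  (\sum_(0 <= j < n.+1) \int[P]_(t in A `&` [set t | zeta t = Some j]) (Z j t)%:E
   + (c n)%:E * P (A `&` alive zeta n) = \int[P]_(t in A) (payoff i t)%:E)%E.
Proof.
move=> gz BA + geZ leZ; have mA := Bfilt_measurable mX BA.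
have first : (\sum_(0 <= j < i.+1) \int[P]_(t in A `&` [set t | zeta t = Some j]) (Z j t)%:E
   + (c i)%:E * P (A `&` alive zeta i) = \int[P]_(t in A) (payoff i t)%:E)%E.
  rewrite sum_first// -alive_first// eq_payoff_split// => t At; first exact: geZ.
  move=> nz; apply: leZ => //.
  by have [] : (A `&` alive zeta i) t by rewrite -alive_first.
elim: n => [|n IH]; first by rewrite leqn0 => /eqP i0; subst i.
rewrite leq_eqVlt => /predU1P[<-//|ni]; rewrite -(IH ni).
have BE : Bfilt X n (A `&` alive zeta n) by apply: BfiltI => //; exact: Bfilt_mono BA.
rewrite big_nat_recr// -addeA -(integral_payoff BE); congr (_ + _)%E.
rewrite -aliveS -alive_hit eq_payoff_split//.
- exact: (Bfilt_measurable mX BE).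
- by move=> t _; exact: geZ.
- move=> t At nz; apply: leZ; first exact: leqW.
  by have [] : (A `&` alive zeta n.+1) t by rewrite -aliveS.
Qed.

Let Zint0 A j : (0 <= \int[P]_(t in A `&` [set t | zeta t = Some j]) (Z j t)%:E)%E.
Proof. by apply: integral_ge0 => t _; rewrite lee_fin Zseq_ge0. Qed.

Lemma le_integral_stopped i A : ge_time i zeta -> Bfilt X i A ->
  (\int[P]_(t in A) (stopped Z zeta t)%:E <= \int[P]_(t in A) (payoff i t)%:E)%E.
Proof.
move=> gz BA; have mA := Bfilt_measurable mX BA.
rewrite (integral_stopped P measurable_Zseq Zseq_ge0 mz mA).
apply: lime_le; first exact: is_cvg_nneseries.
exists i.+1 => // -[//|n] /= ni; apply: le_trans (le_partial_stopped gz BA ni).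
by rewrite leeDl// mule_ge0// lee_fin c0.
Qed.

Lemma eq_integral_stopped i A : ge_time i zeta -> Bfilt X i A ->
  (forall j t, zeta t = Some j -> c j <= Z j t) ->
  (forall j t, (i <= j)%N -> alive zeta j t -> Z j t <= c j) ->
  (\int[P]_(t in A) (stopped Z zeta t)%:E = \int[P]_(t in A) (payoff i t)%:E)%E.
Proof.
move=> gz BA geZ leZ; have mA := Bfilt_measurable mX BA.
apply/eqP; rewrite eq_le le_integral_stopped//=.
rewrite (integral_stopped P measurable_Zseq Zseq_ge0 mz mA).
apply/lee_addgt0Pr => e e0.
(* Convergence of [c] to 0 enters here: at a late [n] the remaining fallback is worth at most
   [e]. *)
have [n [ni cn]] : exists n, (i <= n)%N /\ c n <= e.
  have /cvgrPdist_le/(_ _ e0)[N _ cN] := ccvg.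
  exists (maxn i N); rewrite leq_maxl; split=> //.
  by have := cN (maxn i N) (leq_maxr _ _); rewrite /= sub0r normrN ger0_norm.
rewrite -(eq_partial_stopped gz BA ni geZ leZ); apply: leeD.
  exact: nneseries_lim_ge.
rewrite -[leRHS]mule1; apply: lee_pmul => //; rewrite ?lee_fin ?c0//.
apply: probability_le1; apply: measurableI => //.
apply: (Bfilt_measurable mX (i := n)); exact: Balive.
Qed.

End Rule.

(** The guard [i <= j] provides one rule for each starting time, as the Snell envelope at time [i]
    demands. *)
Definition threshold_rule (i : nat) : T -> option nat :=
  first_hit (fun j t => (i <= j)%N && (c j <= Z j t)).

Lemma threshold_rule_stopping i : stopping_time (Bfilt X) (threshold_rule i).
Proof.
apply: first_hit_stopping => j; case: leqP => ij /=.
  by apply: (Bfilt_le (@G_measurable_cst j (c j))); exact: G_measurable_Zseq.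
rewrite (_ : mkset _ = set0); last by apply/seteqP; split.
by rewrite BfiltE; exact: measurable0.
Qed.

Lemma ge_threshold_rule i : ge_time i (threshold_rule i).
Proof. by move=> t; case E : threshold_rule => [j|//]; move/first_hitP : E => [/andP[]]. Qed.

Lemma threshold_rule_optimal i A : Bfilt X i A ->
  (\int[P]_(t in A) (stopped Z (threshold_rule i) t)%:E =
   \int[P]_(t in A) (payoff i t)%:E)%E.
Proof.
move=> BA; apply: eq_integral_stopped => //.
- exact: threshold_rule_stopping.
- exact: ge_threshold_rule.
- by move=> j t /first_hitP[/andP[]].
- move=> j t ij al; rewrite leNgt; apply/negP => cZ; apply: al.
  by apply: first_hit_le; rewrite ij ltW.
Qed.

Let integral_payoff0 : (\int[P]_t (payoff 0 t)%:E = (c 0%N)%:E)%E.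
Proof.
rewrite -[RHS]int_cst; apply: eq_integral => t _.
by rewrite /payoff max_r// /Z /=.
Qed.

Lemma expect_threshold_rule : expect_stopped P Z (threshold_rule 0) = (c 0%N)%:E.
Proof.
by rewrite /expect_stopped threshold_rule_optimal ?integral_payoff0//; exact: BfiltT.
Qed.

Lemma value_Zseq : value P (Bfilt X) Z = (c 0%N)%:E.
Proof.
apply/eqP; rewrite eq_le; apply/andP; split.
  apply: ge_ereal_sup => _ [zeta sz <-]; rewrite -integral_payoff0.
  apply: le_integral_stopped => //; last exact: BfiltT.
  by move=> t; case: (zeta t).
apply: ereal_sup_ubound; exists (threshold_rule 0); last exact: expect_threshold_rule.
exact: threshold_rule_stopping.
Qed.

(** Rules built from versions of conditional expectations match the threshold rule only almost
    surely, which suffices for the expectation. *)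
Lemma expect_ae_threshold_rule zeta : stopping_time (Bfilt X) zeta ->
  {ae P, forall t, zeta t = threshold_rule 0 t} ->
  expect_stopped P Z zeta = value P (Bfilt X) Z.
Proof.
move=> sz zae; rewrite value_Zseq -expect_threshold_rule.
have mst xi : stopping_time (Bfilt X) xi ->
    measurable_fun setT (fun t => (stopped Z xi t)%:E).
  move=> sx; apply/measurable_EFinP; apply: measurable_stopped measurable_Zseq _.
  by move=> i; apply: (Bfilt_measurable mX (i := i)); exact: sx.
apply: ae_eq_integral => //; [exact: mst|by apply: mst; exact: threshold_rule_stopping|].
by apply: filterS zae => t zt _; rewrite /stopped zt.
Qed.

(** * Identification of the Snell and backward induction rules *)

Let null_ae (N : set T) (Q : T -> Prop) : measurable N -> P N = 0%E ->
  (forall t, ~ N t -> Q t) -> {ae P, forall t, Q t}.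
Proof.
by move=> mN N0 NQ; exists N; split=> // t /= nQ; apply: contrapT => /NQ.
Qed.

(** On [Bfilt X i], [C] and the constant [c i] have equal integrals. Testing on [C < c i] and
    [c i < C], which belong to [Bfilt X i], shows that both events are null. *)
Lemma cexp_payoff_ae i W C : measurable_fun setT W ->
  {ae P, forall t, W t = payoff i.+1 t} -> cexp_version P (Bfilt X i) W C ->
  {ae P, forall t, C t = c i}.
Proof.
move=> mW Wae [mC iC CW].
have intC A : Bfilt X i A -> (\int[P]_(t in A) (C t)%:E = \int[P]_(t in A) (c i)%:E)%E.
  move=> BA; have mA := Bfilt_measurable mX BA.
  rewrite CW// [RHS]integral_cst// -integral_payoff//.
  apply: ae_eq_integral => //.
  - by apply: measurable_funTS; apply/measurable_EFinP.
  - by apply: measurable_funTS; apply/measurable_EFinP; exact: measurable_payoff.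
  - by apply: filterS Wae => t -> _.
have Blt := Bfilt_lt mC (@G_measurable_cst i (c i)).
have Bgt := Bfilt_lt (@G_measurable_cst i (c i)) mC.
have mlt := Bfilt_measurable mX Blt; have mgt := Bfilt_measurable mX Bgt.
apply: (null_ae (measurableU _ _ mlt mgt)).
  have Plt := le_integral_null mlt (icst (c i)) iC (fun t h => h).
  have Pgt := le_integral_null mgt iC (icst (c i)) (fun t h => h).
  apply/eqP; rewrite eq_le measure_ge0 andbT; apply: le_trans (measureU2 _ _ _) _ => //.
  by rewrite [X in (X + _)%E]Plt ?intC// [X in (_ + X)%E]Pgt ?intC// adde0.
by move=> t /= nN; apply/eqP; rewrite eq_le !leNgt; apply/andP; split; apply/negP => ?;
  apply: nN; [right|left].
Qed.

(** By optimality of [threshold_rule i], [payoff i] is itself a member of the family. It dominates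
    every other member [f] almost surely, since [le_integral_stopped] makes the event [payoff i < f]
    null. *)
Lemma snell_envelope_ae V : snell_envelope P (Bfilt X) Z V ->
  forall i, {ae P, forall t, V i t = payoff i t}.
Proof.
move=> snV i; have [mV ubV lubV] := snV i.
have : {ae P, forall t, payoff i t <= V i t}.
  apply: ubV; exists (threshold_rule i); split.
  - exact: threshold_rule_stopping.
  - exact: ge_threshold_rule.
  - split; [exact: G_measurable_payoff|exact: integrable_payoff|].
    by move=> A BA; rewrite threshold_rule_optimal.
have : {ae P, forall t, V i t <= payoff i t}.
  apply: lubV; first exact: measurable_payoff.
  move=> f [zeta [sz gz [mf itf fZ]]].
  have Blt := Bfilt_lt (@G_measurable_payoff i) mf.
  have mlt := Bfilt_measurable mX Blt.
  apply: (null_ae mlt); last by move=> t /= /negP; rewrite -leNgt.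
  apply: (le_integral_null mlt itf (integrable_payoff i)) => //.
  by rewrite fZ//; exact: le_integral_stopped.
by apply: filterS2 => t; move=> h1 h2; apply/eqP; rewrite eq_le h1.
Qed.

Lemma snell_rule_stopping_optimal V C : snell_envelope P (Bfilt X) Z V ->
  (forall i, cexp_version P (Bfilt X i) (V i.+1) (C i)) ->
  stopping_time (Bfilt X) (snell_rule Z C) /\
  expect_stopped P Z (snell_rule Z C) = value P (Bfilt X) Z.
Proof.
move=> snV CV.
have sz : stopping_time (Bfilt X) (snell_rule Z C).
  apply: first_hit_stopping => i; have [mC _ _] := CV i.
  exact: Bfilt_le mC (@G_measurable_Zseq i).
split=> //; apply: expect_ae_threshold_rule => //.
(* A single null set must serve all [i], because the hitting time depends on the whole sequence. *)
have : {ae P, forall t, forall i, C i t = c i}.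
  apply: ae_foralln => i; have [mV _ _] := snV i.+1.
  exact: cexp_payoff_ae mV (snell_envelope_ae snV i.+1) (CV i).
by apply: filterS => t Cc; apply: eq_first_hit => i _; rewrite Cc.
Qed.

(** Absorbs the forced stop at [m] into the hitting condition. *)
Lemma bi_ruleE m C t : bi_rule m Z C t =
  first_hit (fun i t => (i == m) || (i < m)%N && (C i t <= Z i t)) t.
Proof.
rewrite /bi_rule; case E : (first_hit _ t) => [i|].
  move/first_hitP : E => [/andP[im CZ] imin]; apply/esym/first_hitP.
  rewrite im CZ orbT; split=> // j /orP[/eqP ->|/imin//]; exact: ltnW.
apply/esym/first_hitP; rewrite eqxx; split=> // j /predU1P[->//|pj].
by have [k _] := first_hit_le (p := fun i t => (i < m)%N && (C i t <= Z i t)) pj; rewrite E.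
Qed.

Lemma bi_rule_stopping_optimal m W C : (forall i, (m < i)%N -> S i = 0) ->
  backward_induction P (Bfilt X) m Z W C ->
  stopping_time (Bfilt X) (bi_rule m Z C) /\
  expect_stopped P Z (bi_rule m Z C) = value P (Bfilt X) Z.
Proof.
move=> Sm [Wm WC].
(* Beyond [m] the discount vanishes, so [reward_or_bounds] makes [c] nondecreasing from [m] on;
   being nonnegative with limit 0, it is 0 at [m]. *)
have cm : c m = 0.
  have cmono n : c m <= c (m + n)%N.
    elim: n => [|n IH]; first by rewrite addn0.
    apply: le_trans IH _; rewrite [leLHS]cE addnS.
    have /andP[_] := reward_or_bounds (m + n).+1 (c0 (m + n).+1).
    by rewrite Sm ?ltnS ?leq_addr// mul0r addr0.
  apply/eqP; rewrite eq_le c0 andbT.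
  apply/ler_addgt0Pr => e e0; rewrite add0r.
  have /cvgrPdist_le/(_ _ e0)[N _ cN] := ccvg; apply: le_trans (cmono N) _.
  by have := cN (m + N)%N (leq_addl _ _); rewrite /= sub0r normrN ger0_norm.
have sz : stopping_time (Bfilt X) (bi_rule m Z C).
  rewrite (funext (bi_ruleE m C)); apply: first_hit_stopping => i.
  case: eqVneq => [_|_] /=.
    by rewrite (_ : mkset _ = setT); [exact: BfiltT|apply/seteqP; split].
  case: ltnP => im /=; last first.
    by rewrite (_ : mkset _ = set0) ?BfiltE; [exact: measurable0|apply/seteqP; split].
  have [[mC _ _] _] := WC _ im.
  exact: Bfilt_le mC (@G_measurable_Zseq i).
split=> //; apply: expect_ae_threshold_rule => //.
(* Backward induction in time, run on [k] with [i = m - k]. It starts from [W m = Z m], which is the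
   payoff because [c m = 0]. *)
have Wae i : (i <= m)%N -> measurable_fun setT (W i) /\ {ae P, forall t, W i t = payoff i t}.
  move=> im; rewrite -(subKn im); elim: (m - i)%N {im} => [|k IH].
    rewrite subn0; split; first by rewrite (funext Wm); exact: measurable_Zseq.
    by apply: aeW => t; rewrite Wm /payoff cm max_l// Zseq_ge0.
  (* For [m <= k] truncated subtraction makes both indices 0, and the induction hypothesis is the
     goal. *)
  have [km|mk] := ltnP k m; last first.
    have k0 : (m - k = 0)%N by apply/eqP; rewrite subn_eq0.
    have k1 : (m - k.+1 = 0)%N by apply/eqP; rewrite subn_eq0 leqW.
    by rewrite k1; rewrite k0 in IH.
  have mkm : (m - k.+1 < m)%N by rewrite -subSn// subSS leq_subr.
  have [CW WE] := WC _ mkm; have [mC _ _] := CW; move: IH CW.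
  have -> : (m - k = (m - k.+1).+1)%N by rewrite -subSn.
  move=> [mW Wp] CW; split.
    rewrite (funext WE); apply: measurable_maxr; first exact: measurable_Zseq.
    exact: (G_measurable_fun mX mC).
  by apply: filterS (cexp_payoff_ae mW Wp CW) => t Cc; rewrite WE Cc.
have : {ae P, forall t, forall i, (i < m)%N -> C i t = c i}.
  apply: ae_foralln => i; case: (ltnP i m) => im; last exact: aeW.
  have [CW _] := WC _ im; have [mW Wp] := Wae i.+1 im.
  by apply: filterS (cexp_payoff_ae mW Wp CW) => t.
apply: filterS => t Cc; rewrite bi_ruleE; apply: eq_first_hit => i ni.
(* Before [m] the tests agree through [C i t = c i]; after [m] the rule has already stopped; at [m]
   the threshold test succeeds because [c m = 0]. *)
have [im|mi|->] := ltngtP i m.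
- by rewrite Cc.
- by have := ni _ mi; rewrite eqxx.
- by rewrite cm Zseq_ge0.
Qed.

End Optimality.

(** * The random horizon *)

Section RandomHorizon.
Context {R : realType} {d : measure_display} {T : measurableType d}.
Variables (P : probability T R) (X : nat -> T -> R) (H : T -> nat).
Hypothesis mX : forall i, (0 < i)%N -> measurable_fun setT (X i).
Hypothesis X0 : forall i, (0 < i)%N -> forall t, 0 <= X i t.
Hypothesis mH : forall n, measurable (H @^-1` [set n]).
Hypothesis indep : horizon_indep P X H.

Let Y := Yseq X H.
Let Z := Zseq P X H.

Lemma Yseq_ge0 i t : 0 <= Y i t.
Proof. by case: i => [//|i]; rewrite /Y /=; case: ifP => // _; exact: X0. Qed.

Lemma measurable_Yseq i : measurable_fun setT (Y i).
Proof.
case: i => [|i]; first exact: measurable_cst.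
apply: measurable_fun_ifT; [|exact: mX|exact: measurable_cst].
by apply: (measurable_fun_bool true); rewrite setTI; exact: measurable_survival.
Qed.

Lemma Yseq_gt_horizon i t : (H t < i)%N -> Y i t = 0.
Proof. by case: i => [//|i] Hi; rewrite /Y /= leqNgt Hi. Qed.

(** Replacing a later or infinite [zeta] by [H + 1] trades one zero reward for another. *)
Lemma stopped_min_horizon zeta : stopped Y (min_horizon zeta H) = stopped Y zeta.
Proof.
apply/funext => t; rewrite /stopped /min_horizon.
case: (zeta t) => [i|]; last exact: Yseq_gt_horizon.
have [iH|Hi] := leqP i (H t).+1; first by [].
by rewrite !Yseq_gt_horizon// ltnW.
Qed.

Lemma expect_stopped_Yseq zeta : stopping_time (Bfilt X) zeta ->
  expect_stopped P Y zeta = expect_stopped P Z zeta.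
Proof.
move=> sz; have mz i : measurable [set t | zeta t = Some i].
  by apply: (Bfilt_measurable mX (i := i)); exact: sz.
rewrite /expect_stopped (integral_stopped P measurable_Yseq Yseq_ge0 mz)//.
rewrite (integral_stopped P (measurable_Zseq P H mX) (Zseq_ge0 P H X0) mz)//.
apply: eq_eseriesr => i _; rewrite setTI; case: i => [//|i].
(* [integral_survival] asks for an integrand nonnegative on all of [R]; the absolute value agrees
   with the identity on the values of [X i.+1]. *)
have mabs : measurable_fun setT (fun x : R => `|x%:E|%E) by apply: measurableT_comp.
have Bz : Bfilt X i.+1 [set t | zeta t = Some i.+1] by exact: sz.
have := integral_survival mX mH indep (ltn0Sn i) Bz mabs (fun=> abse_ge0 _).
have absX t : `|(X i.+1 t)%:E|%E = (X i.+1 t)%:E by rewrite gee0_abs// lee_fin X0.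
under eq_integral do rewrite absX; under [in RHS]eq_integral do rewrite absX.
rewrite -ge0_integralZl//; first last.
- by rewrite lee_fin; exact: surv_ge0.
- by move=> t _; rewrite lee_fin X0.
- by apply: measurable_funTS; apply/measurable_EFinP; exact: mX.
move=> <-; rewrite integral_mkcondr; apply: eq_integral => t _.
rewrite patchE /Y /=; case: (boolP (i < H t)%N) => iH; first by rewrite mem_set.
by rewrite memNset//; exact/negP.
Qed.

Let Fgen i := [set A | (exists j (B : set R),
    (0 < j <= i)%N /\ measurable B /\ A = X j @^-1` B)
  \/ (exists j, (j < i)%N /\ A = H @^-1` [set j])].

Lemma FfiltE i : Ffilt X H i = (Fgen i).-sigma.-measurable.
Proof. by []. Qed.

Lemma Ffilt_measurable i : Ffilt X H i `<=` measurable.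
Proof.
apply: smallest_sub; first exact: sigma_algebra_measurable.
move=> A [[k [D [/andP[k0 ki] [mD ->]]]]|[j [_ ->]]]; last exact: mH.
by rewrite -[_ @^-1` _]setTI; exact: mX.
Qed.

Lemma Bfilt_Ffilt i : Bfilt X i `<=` Ffilt X H i.
Proof. by apply: sub_sigma_algebra2 => A BA; left. Qed.

Lemma Ffilt_horizon i j : (j < i)%N -> Ffilt X H i (H @^-1` [set j]).
Proof. by move=> ji; apply: sub_sigma_algebra; right; exists j. Qed.

Lemma min_horizon_stopping zeta : stopping_time (Bfilt X) zeta ->
  stopping_time (Ffilt X H) (min_horizon zeta H).
Proof.
move=> sz i.
(* Either [zeta = i] with [i <= H + 1], or [H + 1 = i] with [zeta > i]. The first excludes only
   values of [H] below [i - 1], hence [i.-1]; the second needs [H = i - 1], which is observable at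
   time [i]. *)
rewrite (_ : mkset _ =
    [set t | zeta t = Some i] `&` (\bigcap_(j in `I_i.-1) ~` (H @^-1` [set j]))
    `|` ((~` [set t | exists2 j, (j <= i)%N & zeta t = Some j])
         `&` [set t | (H t).+1 = i])).
  rewrite FfiltE; apply: measurableU; apply: measurableI.
  - exact: Bfilt_Ffilt (sz i).
  - apply: bigcap_measurableType => j /= ji; apply: measurableC.
    by apply: Ffilt_horizon; rewrite (leq_trans ji)// leq_pred.
  - by apply: measurableC; apply: Bfilt_Ffilt; exact: stopping_le.
  - case: i => [|i].
      by rewrite (_ : mkset _ = set0); [exact: measurable0|apply/seteqP; split].
    rewrite (_ : mkset _ = H @^-1` [set i]); first exact: Ffilt_horizon.
    by apply/seteqP; split => t /= => [[]|->].
have capE t : (\bigcap_(j in `I_i.-1) ~` (H @^-1` [set j])) t <-> (i <= (H t).+1)%N.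
  split=> [iH|iH j /= ji Hj]; last first.
    by move: iH ji; rewrite Hj; case: (i) => //= k; rewrite ltnS ltnNge => ->.
  rewrite leqNgt; apply/negP => Hi; apply: (iH (H t)) => //=.
  by move: Hi; case: (i).
apply/seteqP; split => t; rewrite /min_horizon/=.
- case zt : (zeta t) => [k|] [].
    have [kH|Hk] := leqP k (H t).+1.
      move=> ki; left; split; first by rewrite ki.
      by apply/capE; rewrite -ki.
    move=> Hi; right; split=> // -[j ji [kj]].
    by move: Hk; rewrite kj Hi ltnNge ji.
  by move=> Hi; right; split=> // -[].
- move=> [[zt /capE iH]|[nz Hi]]; first by rewrite zt (minn_idPl iH).
  case zt : (zeta t) => [k|]; last by rewrite Hi.
  congr Some; rewrite Hi; apply/minn_idPr; rewrite leqNgt; apply/negP => ki.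
  by apply: nz; exists k => //; exact: ltnW.
Qed.

(* Before the horizon the indicators generating [Ffilt] carry no information
   beyond survival, so that both filtrations have the same trace. *)
Lemma Ffilt_trace i A : Ffilt X H i A ->
  exists2 D, Bfilt X i D & A `&` [set t | (i <= H t)%N] = D `&` [set t | (i <= H t)%N].
Proof.
set E := mkset _; move: A.
apply: (smallest_sub (X := [set A | exists2 D, Bfilt X i D & A `&` E = D `&` E])).
  split.
  - by exists set0 => //; rewrite BfiltE; exact: measurable0.
  - move=> A [D BD AD]; exists (~` D); first exact: BfiltC.
    rewrite setTD; apply/seteqP; split => t [nt Et]; split=> // h; apply: nt.
      by have [] : (A `&` E) t by rewrite AD.
    by have [] : (D `&` E) t by rewrite -AD.
  - move=> A CA; have /choice[D DP] : forall n, exists D,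
        Bfilt X i D /\ A n `&` E = D `&` E.
      by move=> n; have [D BD AD] := CA n; exists D.
    exists (\bigcup_n D n).
      by rewrite BfiltE; apply: bigcupT_measurable => n; have [] := DP n.
    by rewrite !setI_bigcupl; apply: eq_bigcupr => n _; have [] := DP n.
move=> A [[k [D [ki [mD ->]]]]|[j [ji ->]]].
  by exists (X k @^-1` D) => //; exact: Bfilt_preimage.
exists set0; first by rewrite BfiltE; exact: measurable0.
by rewrite set0I; apply/seteqP; split=> // t [/= Ht]; rewrite /E /= Ht leqNgt ji.
Qed.

(** Let [D i] be a trace of [tau = i] in [Bfilt X i], and let [zeta] be the first [i] whose [D i]
    occurs. If [tau = i <= H], an earlier [D j] would force [tau = j], so [zeta = i]; otherwise the
    reward at [tau] is 0. *)
Lemma stopped_Yseq_dominated tau : stopping_time (Ffilt X H) tau ->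
  exists2 zeta, stopping_time (Bfilt X) zeta &
    forall t, stopped Y tau t <= stopped Y zeta t.
Proof.
move=> st.
have /choice[D DE] : forall i, exists D, Bfilt X i D /\
    [set t | tau t = Some i] `&` [set t | (i <= H t)%N] = D `&` [set t | (i <= H t)%N].
  by move=> i; have [D BD DE] := Ffilt_trace (st i); exists D.
exists (first_hit (fun i t => `[< D i t >])).
  apply: first_hit_stopping => i; have [BD _] := DE i.
  by rewrite (_ : mkset _ = D i)//; apply/seteqP; split => t /asboolP.
move=> t; have tauE i : (i <= H t)%N -> (tau t = Some i) <-> D i t.
  move=> iH; have [_ /seteqP[h1 h2]] := DE i.
  by split=> h; [have [] := h1 t (conj h iH)|have [] := h2 t (conj h iH)].
rewrite [leLHS]/stopped; case tt : (tau t) => [i|]; last by apply: stopped_ge0; exact: Yseq_ge0.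
have [iH|Hi] := leqP i (H t); last first.
  by rewrite Yseq_gt_horizon//; apply: stopped_ge0; exact: Yseq_ge0.
have zt : first_hit (fun i t => `[< D i t >]) t = Some i.
  apply/first_hitP; split; first by apply/asboolP/tauE.
  move=> j /asboolP Djt; rewrite leqNgt; apply/negP => ji.
  have /tauE := Djt; rewrite tt (leq_trans (ltnW ji) iH) => /(_ isT) [ij].
  by rewrite ij ltnn in ji.
by rewrite /stopped zt.
Qed.

Lemma value_Yseq : value P (Ffilt X H) Y = value P (Bfilt X) Z.
Proof.
apply/eqP; rewrite eq_le; apply/andP; split; apply: ge_ereal_sup => _ [tau st <-].
  have [zeta sz le_tz] := stopped_Yseq_dominated st.
  have mz i : measurable [set t | zeta t = Some i].
    by apply: (Bfilt_measurable mX (i := i)); exact: sz.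
  have mt i : measurable [set t | tau t = Some i].
    by apply: (Ffilt_measurable (i := i)); exact: st.
  apply: (@le_trans _ _ (expect_stopped P Y zeta)); last first.
    by rewrite expect_stopped_Yseq//; apply: ereal_sup_ubound; exists zeta.
  apply: ge0_le_integral => //.
  - by move=> t _; rewrite lee_fin; apply: stopped_ge0; exact: Yseq_ge0.
  - by apply/measurable_EFinP; exact: measurable_stopped measurable_Yseq mt.
  - by apply/measurable_EFinP; exact: measurable_stopped measurable_Yseq mz.
  - by move=> t _; rewrite lee_fin.
rewrite -[X in (X <= _)%E]/(expect_stopped P Z tau) -expect_stopped_Yseq//.
apply: ereal_sup_ubound; exists (min_horizon tau H); first exact: min_horizon_stopping.
by rewrite stopped_min_horizon.
Qed.

Lemma optimal_min_horizon zeta : stopping_time (Bfilt X) zeta ->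
  expect_stopped P Z zeta = value P (Bfilt X) Z ->
  [/\ stopping_time (Bfilt X) zeta, expect_stopped P Z zeta = value P (Bfilt X) Z,
      stopping_time (Ffilt X H) (min_horizon zeta H) &
      expect_stopped P Y (min_horizon zeta H) = value P (Ffilt X H) Y].
Proof.
move=> sz zE; split=> //; first exact: min_horizon_stopping.
by rewrite value_Yseq /expect_stopped stopped_min_horizon -zE -expect_stopped_Yseq.
Qed.

(** A truncated tail-sum formula for the mean: the survival indicators add up to [min(n, H + 1)],
    and the extra 1 is the term [i = 0]. *)
Lemma surv_sum_le n : (\int[P]_t ((H t)%:R)%:E < +oo)%E ->
  \sum_(i < n) surv P H i <= 1 + fine (\int[P]_t ((H t)%:R)%:E)%E.
Proof.
move=> EH; have mHR : measurable_fun setT (fun t => (H t)%:R : R).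
  apply: (@measurableT_comp _ _ _ _ _ _ (fun k : nat => k%:R : R)) => //.
  move=> _ D _; rewrite setTI (_ : _ @^-1` _ = \bigcup_(k in D) (H @^-1` [set k])).
    exact: bigcup_measurable.
  by apply/seteqP; split => [t Dt|t [k Dk /= ->]//]; exists (H t).
have H0 t : (0 <= ((H t)%:R : R)%:E)%E by rewrite lee_fin.
rewrite -lee_fin EFinD fineK; last by rewrite ge0_fin_numE// integral_ge0.
have mI i : measurable_fun setT (fun t => (\1_[set t | (i <= H t)%N] t : R)%:E).
  by apply/measurable_EFinP; apply: measurable_indic; exact: measurable_survival.
have I0 i t : (0 <= (\1_[set t | (i <= H t)%N] t : R)%:E)%E by rewrite lee_fin.
have -> : (\sum_(i < n) surv P H i)%:E =
    (\int[P]_t \sum_(i < n) (\1_[set t | (i <= H t)%N] t)%:E)%E.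
  rewrite ge0_integral_sum// -sumEFin; apply: eq_bigr => i _.
  by rewrite integral_indic ?setIT ?survE//; exact: measurable_survival.
have -> : (1%:E = \int[P]_t 1%:E)%E.
  by rewrite integral_cst// mul1e; apply/esym; exact: probability_setT.
rewrite -ge0_integralD//; last exact/measurable_EFinP.
apply: ge0_le_integral => //.
- by move=> t _; exact: sume_ge0.
- exact: emeasurable_sum.
- by apply: emeasurable_funD => //; exact/measurable_EFinP.
move=> t _; rewrite sumEFin -EFinD lee_fin addrC.
under eq_bigr do rewrite indicE mem_setE.
rewrite -natr_sum natr1 ler_nat.
have -> : (\sum_(i < n) (i <= H t) = minn n (H t).+1)%N; last exact: geq_minr.
elim: n => [|n IH]; first by rewrite big_ord0 min0n.
rewrite big_ord_recr/= IH; have [nH|Hn] := leqP n (H t).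
  by rewrite addn1 (minn_idPl (leqW nH)) (minn_idPl _).
by rewrite addn0 (minn_idPr Hn) (minn_idPr (leqW Hn)).
Qed.

End RandomHorizon.

Lemma supp_max_surv (R : realType) d (T : measurableType d) (P : probability T R)
    (H : T -> nat) m i :
  (forall n, measurable (H @^-1` [set n])) -> supp_max P H m -> (m < i)%N ->
  surv P H i = 0.
Proof.
move=> mH [_ Hm] mi; rewrite /surv (_ : mkset _ = \bigcup_k (H @^-1` [set (i + k)%N])).
  suff : P.-negligible (\bigcup_k (H @^-1` [set (i + k)%N])).
    by move/measure_negligible => ->//; exact: bigcupT_measurable.
  apply: negligible_bigcup => k; apply/negligibleP => //.
  by apply: Hm; rewrite (leq_trans mi)// leq_addr.
apply/seteqP; split => [t /= iH|t [k _ /= ->]]; last exact: leq_addr.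
by exists (H t - i)%N => //=; rewrite subnKC.
Qed.

Theorem theorem5 (R : realType) (d : measure_display) (T : measurableType d)
  (P : probability T R) (X : nat -> T -> R) (H : T -> nat) :
  (* X_1, X_2, ... : nonnegative, integrable, i.i.d. *)
  (forall i, (0 < i)%N -> measurable_fun setT (X i)) ->
  (forall i, (0 < i)%N -> forall t, 0 <= X i t) ->
  P.-integrable setT (EFin \o X 1%N) ->
  ident_distr P X ->
  (* H : nat-valued random variable independent of (X_i), with E H < oo *)
  (forall n, measurable (H @^-1` [set n])) ->
  horizon_indep P X H ->
  (\int[P]_t ((H t)%:R)%:E < +oo)%E ->
  let Y := Yseq X H in
  let Z := Zseq P X H in
  let F := Ffilt X H in
  let B := Bfilt X in
  (* (a) *)
  value P F Y = value P B Z /\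
  (* (b), (c) *)
  (exists zeta, [/\ stopping_time B zeta, expect_stopped P Z zeta = value P B Z,
                   stopping_time F (min_horizon zeta H) &
                   expect_stopped P Y (min_horizon zeta H) = value P F Y]) /\
  (* moreover, m < oo: backward induction rule for Z_0, ..., Z_m *)
  (forall m, supp_max P H m ->
     forall W C, backward_induction P B m Z W C ->
       let zeta := bi_rule m Z C in
       [/\ stopping_time B zeta, expect_stopped P Z zeta = value P B Z,
           stopping_time F (min_horizon zeta H) &
           expect_stopped P Y (min_horizon zeta H) = value P F Y]) /\
  (* moreover, m = oo: Snell rule *)
  (supp_unbounded P H ->
     forall V C, snell_envelope P B Z V ->
       (forall i, cexp_version P (B i) (V i.+1) (C i)) ->
       let zeta := snell_rule Z C in
       [/\ stopping_time B zeta, expect_stopped P Z zeta = value P B Z,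
           stopping_time F (min_horizon zeta H) &
           expect_stopped P Y (min_horizon zeta H) = value P F Y]).
Proof.
move=> mX X0 iX idX mH indep EH Y Z F B.
have opt zeta := @optimal_min_horizon _ _ _ P X H mX X0 mH indep zeta.
pose EX := fine (\int[P]_t (X 1%N t)%:E)%E.
have EX0 : 0 <= EX by rewrite fine_ge0// integral_ge0// => t _; rewrite lee_fin X0.
(* The finite mean of [H] is used here: it makes the increments [surv P H i * EX] summable, so that
   the recursion has a solution tending to 0. *)
have [c [c0 cE ccvg]] : exists c : nat -> R, [/\ forall i, 0 <= c i,
    forall i, c i = reward_or P X H i.+1 (c i.+1) & c n @[n --> \oo] --> 0].
  apply: (@backward_recursion _ (reward_or P X H) (fun i => surv P H i * EX)
    ((1 + fine (\int[P]_t ((H t)%:R)%:E)%E) * EX)).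
  - by move=> i x x0; exact: reward_or_bounds.
  - by move=> i x y xy; exact: reward_or_lipschitz.
  - by move=> n; rewrite -mulr_suml ler_wpM2r// surv_sum_le.
split; first exact: value_Yseq.
split; [|split].
- exists (threshold_rule P X H c 0); apply: opt; first exact: threshold_rule_stopping.
  rewrite expect_threshold_rule//; apply/esym.
  exact: (value_Zseq mX X0 iX idX indep c0 cE ccvg).
- move=> m Hm W C WC.
  have [sz zE] := bi_rule_stopping_optimal mX X0 iX idX indep c0 cE ccvg
    (fun i => supp_max_surv mH Hm) WC.
  exact: opt.
- move=> _ V C snV CV.
  have [sz zE] := snell_rule_stopping_optimal mX X0 iX idX indep c0 cE ccvg snV CV.
  exact: opt.
Qed.
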